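(* Let $\mu$ be a measure on $\mathbb{B}_m\subset\mathbb{C}^m$ which satisfies Lusin's condition (N), and let $K$ be a $\mu$-measurable subset of $\mathbb{B}_m$ such that $0<\mu(K)<+\infty$. (1) There exists a unique point $a=a(K)\in\mathbb{B}_m$ such that $$\int_K p_a(z)\,d\mu(z)=0,$$ where $$p_a(z)=\frac{a-P_az-s_aQ_az}{1-\langle z,a\rangle}.$$ (2) The point $a(K)$ is the minimum of the function $$L(z)=-\int_K\log\frac{(1-|z|^2)(1-|w|^2)}{|1-\langle z,w\rangle|^2}\,d\mu(w),\qquad z\in\mathbb{B}_m.$$
   Context: On $\mathbb{C}^m$, $\langle z,w\rangle=\sum_{k=1}^m z_k\overline{w_k}$ and $|z|=\sqrt{\langle z,z\rangle}$; $\mathbb{B}_m=\{z\in\mathbb{C}^m:|z|<1\}$. For $a\in\mathbb{B}_m$: $P_a$ is the orthogonal projection of $\mathbb{C}^m$ onto the subspace spanned by $a$, i.e. $P_0=0$ and $P_az=\frac{\langle z,a\rangle}{\langle a,a\rangle}a$ for $a\ne0$; $Q_a=I-P_a$; $s_a=(1-|a|^2)^{1/2}$. Measures are defined on the Borel $\sigma$-algebra of $\mathbb{B}_m$. Lusin's condition (N): for every Borel set $E\subseteq\mathbb{B}_m$, if $\mu(E)=0$ then $\mu(q(E))=0$ for every holomorphic automorphism $q$ of $\mathbb{B}_m$. *)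

(* Defs.v *)
From HB Require Import structures.
From mathcomp Require Import all_boot all_order all_algebra complex.
From mathcomp Require Import all_classical all_reals all_analysis.

Set Implicit Arguments.
Unset Strict Implicit.
Unset Printing Implicit Defensive.

Import Order.TTheory GRing.Theory Num.Theory.
Import numFieldNormedType.Exports.

Local Open Scope classical_set_scope.
Local Open Scope ring_scope.
Local Open Scope complex_scope.

(* R[i] with the topology and normed-module structure of its modulus, exactly
   as the library does for the generic numeric fields. *)
HB.instance Definition _ (R : rcfType) := PseudoPointedMetric.copy R[i] R[i]^o.
HB.instance Definition _ (R : rcfType) := GRing.ComAlgebra.copy R[i] R[i]^o.
HB.instance Definition _ (R : rcfType) := Vector.copy R[i] R[i]^o.
HB.instance Definition _ (R : rcfType) := NormedModule.copy R[i] R[i]^o.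

Section HermitianSpace.
Context {R : realType} {m : nat}.
Implicit Types z w : 'cV[R[i]]_m.

Definition inner z w : R[i] := \sum_(k < m) z k 0 * (w k 0)^*.

(* [inner z z] is real, so taking its real part loses nothing. *)
Definition enorm z : R := Num.sqrt (complex.Re (inner z z)).

End HermitianSpace.

Definition unit_ball (R : realType) (m : nat) : set 'cV[R[i]]_m :=
  [set z | enorm z < 1].
Arguments unit_ball : clear implicits.

(* The unit ball as a type of its own, with the topology induced from C^m:
   the topology of 'cV[R[i]]_m comes from the sup norm, which is equivalent to
   [enorm]. *)
Definition Ball (R : realType) (m : nat) : Type := set_type (unit_ball R m).

HB.instance Definition _ (R : realType) (m : nat) :=
  Topological.copy (Ball R m) (set_type (unit_ball R m)).

Definition ball_val (R : realType) (m : nat) (z : Ball R m) : 'cV[R[i]]_m :=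
  set_val z.
Coercion ball_val : Ball >-> matrix.

Lemma unit_ball0 (R : realType) (m : nat) :
  (0 : 'cV[R[i]]_m) \in unit_ball R m.
Proof.
rewrite inE /unit_ball /= /enorm /inner big1 ?sqrtr0 ?ltr01 // => k _.
by rewrite mxE mul0r.
Qed.

(* Required by [g_sigma_algebraType]; the choice of the point is irrelevant. *)
HB.instance Definition _ (R : realType) (m : nat) :=
  isPointed.Build (Ball R m)
    (exist (fun z => z \in unit_ball R m) 0 (unit_ball0 R m)).

Notation borelBall R m := (g_sigma_algebraType (@open (Ball R m))).

Section BallMaps.
Context {R : realType} {m : nat}.

(* [differentiable] over the field R[i] is complex differentiability; it only
   depends on the values of [F] near [z], hence only on [f]. *)
Definition holomorphic (f : Ball R m -> Ball R m) : Prop :=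
  exists F : 'cV[R[i]]_m -> 'cV[R[i]]_m,
    forall z : Ball R m,
      F (z : 'cV[R[i]]_m) = f z :> 'cV[R[i]]_m /\
      differentiable F (z : 'cV[R[i]]_m).

Definition holomorphic_automorphism (q : Ball R m -> Ball R m) : Prop :=
  holomorphic q /\
  exists2 r : Ball R m -> Ball R m,
    holomorphic r & cancel q r /\ cancel r q.

Definition lusinN (mu : {measure set (borelBall R m) -> \bar R}) : Prop :=
  forall E : set (borelBall R m), measurable E -> mu E = 0%E ->
  forall q : Ball R m -> Ball R m, holomorphic_automorphism q ->
    mu (q @` E) = 0%E.

Definition projP (a z : 'cV[R[i]]_m) : 'cV[R[i]]_m :=
  if a == 0 then 0 else (inner z a / inner a a) *: a.

Definition projQ (a z : 'cV[R[i]]_m) : 'cV[R[i]]_m := z - projP a z.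

Definition s_ (a : 'cV[R[i]]_m) : R := Num.sqrt (1 - enorm a ^+ 2).

Definition p_ (a z : 'cV[R[i]]_m) : 'cV[R[i]]_m :=
  (1 - inner z a)^-1 *: (a - projP a z - (s_ a)%:C *: projQ a z).

Definition logker (z w : 'cV[R[i]]_m) : R :=
  ln ((1 - enorm z ^+ 2) * (1 - enorm w ^+ 2) / Normc.normc (1 - inner z w) ^+ 2).

End BallMaps.

(* The integral of a C^m-valued function, taken componentwise on real and
   imaginary parts. Nonintegrable components would get a junk value; this does
   not happen for [p_ b], which is bounded on the ball, over a set of finite
   measure. *)
Definition vintegral d (T : measurableType d) (R : realType) (m : nat)
    (nu : {measure set T -> \bar R}) (D : set T) (f : T -> 'cV[R[i]]_m) :
    'cV[R[i]]_m :=
  \col_k ((\int[nu]_(x in D) complex.Re (f x k 0)) +i*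
          (\int[nu]_(x in D) complex.Im (f x k 0)))%R.

(* [mu ^*] is the outer measure generated by [mu]; restricted to its
   Caratheodory-measurable sets, i.e. to the mu-measurable sets, it is a
   measure that extends [mu]. *)
Notation mu_type mu := (caratheodory_type (mu ^*)%mu).
Notation completion mu := (@completed_measure_extension _ _ _ mu).

Section Functional.
Context {R : realType} {m : nat}.
Variables (mu : {measure set (borelBall R m) -> \bar R}) (K : set (mu_type mu)).

(* The integrand is nonpositive, and its integral may be -oo; hence the values
   of [L_] are taken in [0, +oo]. *)
Definition L_ (z : Ball R m) : \bar R :=
  (- \int[completion mu]_(w in K)
       (logker z (w : Ball R m))%:E)%E.

End Functional.

(* Main.v *)
Require Import Defs.
From HB Require Import structures.
From mathcomp Require Import all_boot all_order all_algebra complex.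
From mathcomp Require Import all_classical all_reals all_analysis.
From mathcomp Require Import measurable_realfun ring lra.
Import Order.TTheory GRing.Theory Num.Theory.
Import numFieldNormedType.Exports.
Local Open Scope classical_set_scope.
Local Open Scope ring_scope.

(**
Put [h (z, w) = ln (|1 - <z, w>|^2 / (1 - |z|^2))] and let [psi z] be its
integral over [w] in [K].  For fixed [z] the kernel [h] is bounded in [w], so
[psi] is finite, and [L_] differs from it by a constant that does not depend on
[z] but may be [+oo].

The identities for [1 - <p_a z, p_a w>] and [1 - <p_a z, w>] give
[h (b, w) - h (a, w) = h (c, p_a w)] both for [c = p_a b] and for [b = p_a c].
- If [c != 0], concavity of [ln] yields [h (c, u) > - k Re <c, u>] on the ball,
  for some constant [k].  Integrated at [u = p_a w], this shows that a point [a]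
  at which the integral of [p_a] vanishes is the strict global minimum of
  [psi]: hence uniqueness, and part (2).
- Conversely [h (t e, u) <= - 2 t Re <e, u> + 3 t^2] for small [t > 0], so the
  integral of [p_a] vanishes wherever [psi] is minimal.
- As a finite measure, [mu] on [K] puts most of its mass on a smaller ball,
  which makes [psi] tend to [+oo] at the boundary; since [psi] is Lipschitz on
  compact subballs, it has a minimum.
*)

Set Implicit Arguments.
Unset Strict Implicit.
Unset Printing Implicit Defensive.

Local Notation "x %:C" := (real_complex _ x) (format "x %:C") : ring_scope.

(** * Complex numbers and the hermitian form *)

Section Modulus.
Context {R : realType}.
Implicit Types x y : R[i].

(** The squared modulus as a real polynomial, within reach of [ring] and [nra]. *)
Definition cmod2 x : R := complex.Re x ^+ 2 + complex.Im x ^+ 2.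

Lemma cReD x y : complex.Re (x + y) = complex.Re x + complex.Re y.
Proof. by case: x y => [? ?] []. Qed.

Lemma cReN x : complex.Re (- x) = - complex.Re x.
Proof. by case: x. Qed.

Lemma cReM x y : complex.Re (x * y) =
  complex.Re x * complex.Re y - complex.Im x * complex.Im y.
Proof. by case: x y => [? ?] []. Qed.

Lemma cImD x y : complex.Im (x + y) = complex.Im x + complex.Im y.
Proof. by case: x y => [? ?] []. Qed.

Lemma cImN x : complex.Im (- x) = - complex.Im x.
Proof. by case: x. Qed.

Lemma cImM x y : complex.Im (x * y) =
  complex.Re x * complex.Im y + complex.Im x * complex.Re y.
Proof. by case: x y => [? ?] []. Qed.

Lemma cReJ x : complex.Re x^* = complex.Re x. Proof. by case: x. Qed.
Lemma cImJ x : complex.Im x^* = - complex.Im x. Proof. by case: x. Qed.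

Lemma cReV x : complex.Re x^-1 = complex.Re x / cmod2 x.
Proof. by case: x. Qed.

Lemma cImV x : complex.Im x^-1 = - (complex.Im x / cmod2 x).
Proof. by case: x. Qed.

Lemma cRe_sum I (s : seq I) (F : I -> R[i]) :
  complex.Re (\sum_(i <- s) F i) = \sum_(i <- s) complex.Re (F i).
Proof. by elim/big_rec2: _ => // i y x _ <-; rewrite cReD. Qed.

Lemma mulcJ x : x * x^* = (cmod2 x)%:C.
Proof.
by apply/eqP; rewrite eq_complex cReM cImM cReJ cImJ /cmod2 /=;
  apply/andP; split; apply/eqP; ring.
Qed.

Lemma conjC_rc (t : R) : (t%:C)^* = t%:C.
Proof. by apply/eqP; rewrite eq_complex cReJ cImJ /= oppr0 !eqxx. Qed.

Lemma cmod2_ge0 x : 0 <= cmod2 x.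
Proof. by rewrite addr_ge0 ?sqr_ge0. Qed.

Lemma cmod2M x y : cmod2 (x * y) = cmod2 x * cmod2 y.
Proof. by rewrite /cmod2 cReM cImM; ring. Qed.

Lemma cmod2J x : cmod2 x^* = cmod2 x.
Proof. by rewrite /cmod2 cReJ cImJ sqrrN. Qed.

Lemma cmod2C (t : R) : cmod2 t%:C = t ^+ 2.
Proof. by rewrite /cmod2 /= expr0n addr0. Qed.

Lemma cmod2_eq0 x : (cmod2 x == 0) = (x == 0).
Proof. by rewrite /cmod2 paddr_eq0 ?sqr_ge0 // !sqrf_eq0 eq_complex. Qed.

Lemma normc_cmod2 x : Normc.normc x ^+ 2 = cmod2 x.
Proof. by case: x => a b /=; rewrite sqr_sqrtr // addr_ge0 ?sqr_ge0. Qed.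

Lemma sqr_Re_le x : complex.Re x ^+ 2 <= cmod2 x.
Proof. by rewrite lerDl sqr_ge0. Qed.

Lemma sqr_Im_le x : complex.Im x ^+ 2 <= cmod2 x.
Proof. by rewrite lerDr sqr_ge0. Qed.

End Modulus.

Section InnerProduct.
Context {R : realType} {m : nat}.
Implicit Types a c z w v : 'cV[R[i]]_m.

Lemma innerDl z w v : inner (z + w) v = inner z v + inner w v.
Proof.
by rewrite /inner -big_split /=; apply: eq_bigr => k _; rewrite mxE mulrDl.
Qed.

Lemma innerZl (x : R[i]) z v : inner (x *: z) v = x * inner z v.
Proof.
by rewrite /inner mulr_sumr; apply: eq_bigr => k _; rewrite mxE mulrA.
Qed.

Lemma innerC z w : inner w z = (inner z w)^*.
Proof.
rewrite /inner rmorph_sum; apply: eq_bigr => k _.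
by rewrite rmorphM /= conjCK mulrC.
Qed.

Lemma innerNl z v : inner (- z) v = - inner z v.
Proof. by rewrite -scaleN1r innerZl mulN1r. Qed.

Lemma innerBl z w v : inner (z - w) v = inner z v - inner w v.
Proof. by rewrite innerDl innerNl. Qed.

Lemma innerBr z w v : inner v (z - w) = inner v z - inner v w.
Proof. by rewrite ![inner v _]innerC innerBl rmorphB. Qed.

Lemma innerZr (x : R[i]) z v : inner v (x *: z) = x^* * inner v z.
Proof. by rewrite ![inner v _]innerC innerZl rmorphM. Qed.

Lemma inner0l v : inner 0 v = 0.
Proof. by rewrite -(scale0r 0) innerZl mul0r. Qed.

Lemma inner0r v : inner v 0 = 0.
Proof. by rewrite innerC inner0l conjC0. Qed.

(** A real-valued squared norm without square roots; membership in the ball is handled as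
    [nsq z < 1]. *)
Definition nsq z : R := \sum_k cmod2 (z k 0).

Lemma innerE z : inner z z = (nsq z)%:C.
Proof.
by rewrite /inner /nsq rmorph_sum; apply: eq_bigr => k _; exact: mulcJ.
Qed.

Lemma nsq_ge0 z : 0 <= nsq z.
Proof. by apply: sumr_ge0 => k _; exact: cmod2_ge0. Qed.

Lemma enormE z : enorm z ^+ 2 = nsq z.
Proof. by rewrite /enorm innerE sqr_sqrtr ?nsq_ge0. Qed.

Lemma nsq_eq0 z : (nsq z == 0) = (z == 0).
Proof.
apply/eqP/eqP => [z0|->]; last first.
  by apply: big1 => k _; apply/eqP; rewrite cmod2_eq0 mxE.
apply/colP => k; rewrite mxE; apply/eqP; rewrite -cmod2_eq0; apply/eqP.
by have := psumr_eq0P (fun i _ => cmod2_ge0 (z i 0)) z0 => ->.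
Qed.

Lemma inner_eq0 z : (inner z z == 0) = (z == 0).
Proof.
by rewrite innerE -(rmorph0 (real_complex R)) (inj_eq (@complexI _)) nsq_eq0.
Qed.

Lemma nsq0 : nsq 0 = 0.
Proof. by apply/eqP; rewrite nsq_eq0. Qed.

Lemma nsqZ (x : R[i]) z : nsq (x *: z) = cmod2 x * nsq z.
Proof.
by rewrite /nsq mulr_sumr; apply: eq_bigr => k _; rewrite mxE cmod2M.
Qed.

Lemma cmod2_coord_le z k : cmod2 (z k 0) <= nsq z.
Proof.
rewrite /nsq (bigD1 k) //= lerDl.
by apply: sumr_ge0 => i _; exact: cmod2_ge0.
Qed.

Lemma unit_ballE z : unit_ball R m z <-> nsq z < 1.
Proof.
rewrite -enormE /unit_ball /=; split => h.
  by rewrite expr_lt1 // sqrtr_ge0.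
by rewrite -(@expr_lt1 _ 2) // sqrtr_ge0.
Qed.

Lemma inner_projP a z w : inner (projP a z) w = inner z (projP a w).
Proof.
rewrite /projP; case: ifPn => [_|a0]; first by rewrite inner0l inner0r.
by rewrite innerZl innerZr rmorphM fmorphV /= -!innerC mulrAC [RHS]mulrC mulrA.
Qed.

Lemma projP_self a : projP a a = a.
Proof.
rewrite /projP; case: ifPn => [/eqP->//|a0].
by rewrite divff ?scale1r // inner_eq0.
Qed.

Lemma projPZ (x : R[i]) a z : projP a (x *: z) = x *: projP a z.
Proof.
rewrite /projP; case: ifPn => _; first by rewrite scaler0.
by rewrite innerZl -mulrA scalerA.
Qed.

Lemma projPB a z w : projP a (z - w) = projP a z - projP a w.
Proof.
rewrite /projP; case: ifPn => _; first by rewrite subr0.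
by rewrite innerBl mulrBl scalerBl.
Qed.

Lemma projPP a z : projP a (projP a z) = projP a z.
Proof.
rewrite {2 3}/projP; case: ifPn => [/eqP->|_]; first by rewrite /projP eqxx.
by rewrite projPZ projP_self.
Qed.

Lemma inner_projP2 a z w : inner (projP a z) (projP a w) = inner (projP a z) w.
Proof. by rewrite -inner_projP projPP. Qed.

(** Multiplying by [inner a a] clears the denominator of the projection, so that [a = 0] is covered
    too. *)
Lemma mul_inner_projP a z w :
  inner a a * inner (projP a z) w = inner z a * inner a w.
Proof.
have [->|a0] := eqVneq a 0; first by rewrite inner0l inner0r !mul0r.
rewrite /projP (negbTE a0) innerZl mulrA mulrCA divff ?mulr1 //.
by rewrite inner_eq0.
Qed.

(** The two sides differ by [nsq w * nsq (projQ w z)], which is nonnegative. *)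
Lemma cauchy_schwarz z w : cmod2 (inner z w) <= nsq z * nsq w.
Proof.
have E : (nsq w * nsq (projQ w z))%:C =
         (nsq z * nsq w - cmod2 (inner z w))%:C.
  rewrite [RHS]rmorphB /= !rmorphM /= -mulcJ -!innerE -innerC /projQ.
  rewrite innerBl !innerBr inner_projP2 -inner_projP subrr subr0.
  by rewrite mulrBr mul_inner_projP mulrC.
by rewrite -subr_ge0 -(complexI E) mulr_ge0 ?nsq_ge0.
Qed.

(** The numerator of [p_ a z], isolated so that the identities below are free of division. *)
Definition pnum a z := a - projP a z - (s_ a)%:C *: projQ a z.

Lemma s_sqr a : nsq a <= 1 -> (s_ a)%:C * (s_ a)%:C = 1 - inner a a.
Proof.
move=> a1; rewrite -rmorphM /s_ enormE -expr2 sqr_sqrtr ?subr_ge0 //.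
by rewrite rmorphB innerE.
Qed.

(** The vector a - P_a z lies in the range of P_a and Q_a z is orthogonal to it, so the cross terms
    vanish. The rest is reduced by s_a^2 = 1 - |a|^2 and |a|^2 <P_a z, w> = <z, a> <a, w>. *)
Lemma inner_pnum a z w : nsq a <= 1 ->
  (1 - inner z a) * (1 - inner a w) - inner (pnum a z) (pnum a w)
  = (1 - inner a a) * (1 - inner z w).
Proof.
move=> a1; have := mul_inner_projP a z w; have := s_sqr a1.
rewrite /pnum /projQ !(innerBl, innerBr, innerZl, innerZr) conjC_rc.
rewrite inner_projP2 -!inner_projP projP_self !(inner_projP a z a) projP_self.
set s := (s_ a)%:C; set al := inner a a; set P := inner (projP a z) w.
set za := inner z a; set aw := inner a w; set zw := inner z w => h1 h2.
transitivity (1 - al + za * aw - P - s * s * (zw - P)); first by ring.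
by rewrite h1 -h2; ring.
Qed.

(** P_a and Q_a are self-adjoint and [s_ a] is real. *)
Lemma pnum_sym a z w :
  1 - inner z a - inner (pnum a z) w = 1 - inner a w - inner z (pnum a w).
Proof.
rewrite /pnum /projQ !(innerBl, innerBr, innerZl, innerZr) conjC_rc.
rewrite -!inner_projP; ring.
Qed.

End InnerProduct.

(** * The involutions [p_a] of the ball *)

Section BallGeometry.
Context {R : realType} {m : nat}.
Implicit Types a b c z w u v e : 'cV[R[i]]_m.

Lemma enorm_ge0 z : 0 <= enorm z. Proof. exact: sqrtr_ge0. Qed.

Lemma enorm_lt1 z : (enorm z < 1) = (nsq z < 1).
Proof. by rewrite -enormE expr_lt1 // enorm_ge0. Qed.

(** This rests on sqrt (1 - d) <= 1 - d / 2. *)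
Lemma enorm_le z (d : R) : 0 <= d -> nsq z <= 1 - d -> enorm z <= 1 - d / 2.
Proof.
move=> d0; rewrite -enormE => h; have := enorm_ge0 z; nra.
Qed.

Lemma sqr_le_absP (x y : R) : 0 <= y -> x ^+ 2 <= y ^+ 2 -> - y <= x <= y.
Proof.
by move=> y0 h; apply/andP; split; nra.
Qed.

Lemma cmod2_inner_le z w : cmod2 (inner z w) <= (enorm z * enorm w) ^+ 2.
Proof. by rewrite exprMn !enormE cauchy_schwarz. Qed.

Lemma Re_inner_bound z w :
  - (enorm z * enorm w) <= complex.Re (inner z w) <= enorm z * enorm w.
Proof.
apply: sqr_le_absP; first by rewrite mulr_ge0 ?enorm_ge0.
exact: le_trans (sqr_Re_le _) (cmod2_inner_le z w).
Qed.

Lemma Im_inner_bound z w :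
  - (enorm z * enorm w) <= complex.Im (inner z w) <= enorm z * enorm w.
Proof.
apply: sqr_le_absP; first by rewrite mulr_ge0 ?enorm_ge0.
exact: le_trans (sqr_Im_le _) (cmod2_inner_le z w).
Qed.

Lemma cmod2_den z w : cmod2 (1 - inner z w) =
  1 - 2 * complex.Re (inner z w) + cmod2 (inner z w).
Proof. by rewrite /cmod2 cReD cImD cReN cImN /=; ring. Qed.

Lemma cmod2_denC z w : cmod2 (1 - inner w z) = cmod2 (1 - inner z w).
Proof. by rewrite !cmod2_den (innerC z w) cReJ cmod2J. Qed.

Lemma cmod2_den_ge z w : nsq z < 1 -> nsq w < 1 ->
  (1 - enorm z * enorm w) ^+ 2 <= cmod2 (1 - inner z w).
Proof.
rewrite -!enorm_lt1 => z1 w1; have /andP[_] := Re_inner_bound z w.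
rewrite cmod2_den /cmod2; have := enorm_ge0 z; have := enorm_ge0 w.
move: (complex.Re _) (complex.Im _) (enorm z) (enorm w) z1 w1 => x y s t *.
have : s * t <= 1 by nra.
by nra.
Qed.

(** One has |1 - <z, w>| >= 1 - |z| |w| >= 1 - |z| >= d / 2, uniformly in [w]. *)
Lemma cmod2_den_ge_sqr z w (d : R) : 0 <= d -> nsq z <= 1 - d -> nsq z < 1 ->
  nsq w < 1 -> (d / 2) ^+ 2 <= cmod2 (1 - inner z w).
Proof.
move=> d0 zd z1 w1; apply: le_trans (cmod2_den_ge z1 w1).
have := enorm_le d0 zd; move: z1 w1; rewrite -!enorm_lt1.
have := enorm_ge0 z; have := enorm_ge0 w.
move: (enorm z) (enorm w) => s t t0 s0 s1 t1 h.
have : s * t <= s by nra.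
by nra.
Qed.

Lemma cmod2_den_gt0 z w : nsq z < 1 -> nsq w < 1 -> 0 < cmod2 (1 - inner z w).
Proof.
move=> z1 w1; apply: lt_le_trans (@cmod2_den_ge_sqr z w (1 - nsq z) _ _ z1 w1).
- by apply: exprn_gt0; lra.
- by lra.
- by lra.
Qed.

Lemma cmod2_den_le4 z w : nsq z < 1 -> nsq w < 1 -> cmod2 (1 - inner z w) <= 4.
Proof.
rewrite -!enorm_lt1 => z1 w1; have /andP[+ _] := Re_inner_bound z w.
have := cmod2_inner_le z w; rewrite cmod2_den.
have := enorm_ge0 z; have := enorm_ge0 w.
move: (complex.Re _) (cmod2 _) (enorm z) (enorm w) z1 w1 => x y s t *.
have : s * t <= 1 by nra.
have : 0 <= s * t by nra.
by nra.
Qed.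

Lemma den_neq0 z w : nsq z < 1 -> nsq w < 1 -> 1 - inner z w != 0.
Proof. by move=> z1 w1; rewrite -cmod2_eq0 gt_eqF // cmod2_den_gt0. Qed.

Lemma p_E a z : p_ a z = (1 - inner z a)^-1 *: pnum a z. Proof. by []. Qed.

Lemma denJ z w : (1 - inner z w)^* = 1 - inner w z.
Proof. by rewrite rmorphB rmorph1 /= -innerC. Qed.

(** This is [inner_pnum] after division. The product form is the one that squared moduli and
    logarithms turn into a linear relation. *)
Lemma den_p_p a z w : nsq a < 1 -> nsq z < 1 -> nsq w < 1 ->
  (1 - inner (p_ a z) (p_ a w)) * ((1 - inner z a) * (1 - inner a w)) =
  (1 - inner a a) * (1 - inner z w).
Proof.
move=> a1 z1 w1; rewrite -inner_pnum ?ltW // !p_E innerZl innerZr fmorphV.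
rewrite /= denJ; field.
by rewrite !den_neq0.
Qed.

(** The counterpart of [den_p_p] coming from [pnum_sym]; it moves [p_ a] from one argument of the
    form to the other. *)
Lemma den_p_sym a c w : nsq a < 1 -> nsq c < 1 -> nsq w < 1 ->
  (1 - inner (p_ a c) w) * (1 - inner c a) =
  (1 - inner c (p_ a w)) * (1 - inner a w).
Proof.
move=> a1 c1 w1; rewrite !p_E innerZl innerZr fmorphV /= denJ.
have := pnum_sym a c w.
set x := inner (pnum a c) w; set y := inner c (pnum a w) => h.
transitivity (1 - inner c a - x); first by field; rewrite den_neq0.
by rewrite h; field; rewrite den_neq0.
Qed.

(** The case [w = z] of [den_p_p], where the two denominators are conjugate. *)
Lemma nsq_p a z : nsq a < 1 -> nsq z < 1 ->
  1 - nsq (p_ a z) = (1 - nsq a) * (1 - nsq z) / cmod2 (1 - inner z a).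
Proof.
move=> a1 z1; have := den_p_p a1 z1 z1.
rewrite -(denJ z a) mulcJ !innerE -[1]/(1%:C) -!rmorphB -!rmorphM.
by move=> /complexI <-; rewrite mulfK // gt_eqF // cmod2_den_gt0.
Qed.

Lemma p_in_ball a z : nsq a < 1 -> nsq z < 1 -> nsq (p_ a z) < 1.
Proof.
move=> a1 z1; rewrite -subr_gt0 nsq_p // divr_gt0 ?cmod2_den_gt0 //.
by rewrite mulr_gt0 // subr_gt0.
Qed.

Lemma p_eq0 a z : nsq a < 1 -> nsq z < 1 -> p_ a z = 0 -> z = a.
Proof.
move=> a1 z1 /eqP; rewrite p_E scaler_eq0 invr_eq0 (negbTE (den_neq0 z1 a1)) /=.
rewrite /pnum => /eqP h.
(* Applying P_a to the numerator kills its Q_a part. What is left of the numerator is s_a Q_a z, and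
   s_a is nonzero in the open ball. *)
have zP : projP a z = a.
  have := congr1 (projP a) h.
  rewrite /projQ !(projPB, projPZ) projPP projP_self.
  rewrite subrr scaler0 subr0 => /eqP.
  by rewrite {2}/projP inner0l mul0r scale0r if_same subr_eq0 => /eqP.
move/eqP: h; rewrite zP subrr sub0r oppr_eq0 scaler_eq0 /projQ zP subr_eq0.
case/orP => /eqP // /complexI/eqP; rewrite sqrtr_eq0 enormE.
by rewrite leNgt subr_gt0 a1.
Qed.

End BallGeometry.

(** * The logarithmic kernel *)

Lemma ln_le_subr1 (R : realType) (x : R) : 0 < x -> ln x <= x - 1.
Proof.
move=> x0; have := @le_ln1Dx R (x - 1).
by rewrite (_ : 1 + (x - 1) = x); [apply; lra | ring].
Qed.

Lemma ln_lt_subr1 (R : realType) (x : R) : 0 < x -> x != 1 -> ln x < x - 1.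
Proof.
move=> x0 x1; have : ln x != 0 by rewrite ln_eq0.
by move/expR_gt1Dx; rewrite lnK ?posrE // => h; lra.
Qed.

Lemma lnB_le (R : realType) (x y : R) : 0 < x -> 0 < y ->
  ln x - ln y <= (x - y) / y.
Proof.
move=> x0 y0; rewrite -ln_div ?posrE // mulrBl divff ?gt_eqF //.
by apply: ln_le_subr1; rewrite divr_gt0.
Qed.

(* [1 - t x] is the convex combination of [1 - t] and [1 + t] with weights
   [(1 + x) / 2] and [(1 - x) / 2]. *)
Lemma ln_chord (R : realType) (t x : R) : 0 < t < 1 -> -1 < x < 1 ->
  (1 + x) * ln (1 - t) + (1 - x) * ln (1 + t) < 2 * ln (1 - t * x).
Proof.
move=> /andP[t0 t1] /andP[x0 x1].
have y0 : 0 < 1 - t * x by nra.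
(* Strict concavity comes from [ln r < r - 1] at the ratio [r] of each endpoint to [1 - t * x];
   [r = 1] would force [x = 1] here and [x = -1] in [h2]. *)
have h1 : ln (1 - t) - ln (1 - t * x) < (1 - t) / (1 - t * x) - 1.
  rewrite -ln_div ?posrE //; last lra.
  apply: ln_lt_subr1; first by apply: divr_gt0 => //; lra.
  apply/eqP => /(congr1 ( *%R^~ (1 - t * x))).
  by rewrite divfK ?gt_eqF // => ?; nra.
have h2 : ln (1 + t) - ln (1 - t * x) < (1 + t) / (1 - t * x) - 1.
  rewrite -ln_div ?posrE //; last lra.
  apply: ln_lt_subr1; first by apply: divr_gt0 => //; lra.
  apply/eqP => /(congr1 ( *%R^~ (1 - t * x))).
  by rewrite divfK ?gt_eqF // => ?; nra.
(* With these weights the endpoints average to [1 - t * x], so the linear bounds cancel. *)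
have h3 : (1 + x) * ((1 - t) / (1 - t * x) - 1) +
          (1 - x) * ((1 + t) / (1 - t * x) - 1) = 0.
  by field; rewrite gt_eqF.
have h1' : (1 + x) * (ln (1 - t) - ln (1 - t * x)) <
           (1 + x) * ((1 - t) / (1 - t * x) - 1) by rewrite ltr_pM2l //; lra.
have h2' : (1 - x) * (ln (1 + t) - ln (1 - t * x)) <
           (1 - x) * ((1 + t) / (1 - t * x) - 1) by rewrite ltr_pM2l //; lra.
lra.
Qed.

Section LogKernel.
Context {R : realType} {m : nat}.
Implicit Types a b c z w u v e : 'cV[R[i]]_m.

(* [- logker z w] without the summand [- ln (1 - |w|^2)], which is unbounded
   in [w] but independent of [z]. *)
Definition hker z w : R := ln (cmod2 (1 - inner z w)) - ln (1 - nsq z).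

Lemma logkerE z w : nsq z < 1 -> nsq w < 1 ->
  logker z w = ln (1 - nsq w) - hker z w.
Proof.
move=> z1 w1; rewrite /logker !enormE normc_cmod2 /hker.
have h := cmod2_den_gt0 z1 w1.
rewrite ln_div ?posrE ?mulr_gt0 ?subr_gt0 // lnM ?posrE ?subr_gt0 //.
by ring.
Qed.

(** The argument of the logarithm is 1 - |p_z w|^2. *)
Lemma logker_le0 z w : nsq z < 1 -> nsq w < 1 -> logker z w <= 0.
Proof.
move=> z1 w1; rewrite /logker !enormE normc_cmod2 cmod2_denC -nsq_p //.
by apply: ln_le0; rewrite gerBl nsq_ge0.
Qed.

Lemma hker0 w : hker 0 w = 0.
Proof.
rewrite /hker inner0l subr0 cmod2C nsq0.
by rewrite expr1n subr0 ln1 subrr.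
Qed.

(** The logarithm of the squared modulus of [den_p_p]: the change of variable [p_ a] moves the
    reference point [a] to the origin. *)
Lemma hker_p_r a b w : nsq a < 1 -> nsq b < 1 -> nsq w < 1 ->
  hker b w - hker a w = hker (p_ a b) (p_ a w).
Proof.
move=> a1 b1 w1; rewrite /hker nsq_p //.
have := congr1 cmod2 (den_p_p a1 b1 w1); rewrite !cmod2M.
rewrite innerE -[1 - _%:C]/((1 : R)%:C - _%:C) -rmorphB cmod2C.
have ba := cmod2_den_gt0 b1 a1; have aw := cmod2_den_gt0 a1 w1.
have bw := cmod2_den_gt0 b1 w1.
have pp := cmod2_den_gt0 (p_in_ball a1 b1) (p_in_ball a1 w1).
have a0 : 0 < 1 - nsq a by rewrite subr_gt0.
have b0 : 0 < 1 - nsq b by rewrite subr_gt0.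
move=> /(congr1 (@ln R)).
rewrite !lnM ?posrE ?mulr_gt0 ?exprn_gt0 ?invr_gt0 // ?lnXn //.
by rewrite lnV ?posrE ?invr_gt0 //; lra.
Qed.

(** Obtained from [den_p_sym] in the same way; it describes the variation of the kernel from [a] to
    the nearby point [p_ a c] when [c] is small. *)
Lemma hker_p_l a c w : nsq a < 1 -> nsq c < 1 -> nsq w < 1 ->
  hker (p_ a c) w - hker a w = hker c (p_ a w).
Proof.
move=> a1 c1 w1; rewrite /hker nsq_p //.
have := congr1 cmod2 (den_p_sym a1 c1 w1); rewrite !cmod2M.
have ca := cmod2_den_gt0 c1 a1; have aw := cmod2_den_gt0 a1 w1.
have pcw := cmod2_den_gt0 (p_in_ball a1 c1) w1.
have cpw := cmod2_den_gt0 c1 (p_in_ball a1 w1).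
have a0 : 0 < 1 - nsq a by rewrite subr_gt0.
have c0 : 0 < 1 - nsq c by rewrite subr_gt0.
move=> /(congr1 (@ln R)).
by rewrite !lnM ?posrE ?mulr_gt0 ?invr_gt0 // lnV ?posrE //; lra.
Qed.

(** Put t = |c| and x = Re <c, u> / t, which lies in ]-1, 1[. Then |1 - <c, u>| >= 1 - t x and 1 -
    t^2 = (1 - t)(1 + t), so [ln_chord] bounds the kernel below by -x (ln (1 + t) - ln (1 - t)),
    which is linear in [u]. *)
Lemma hker_gt_linear c : c != 0 -> nsq c < 1 ->
  exists k : R, forall u, nsq u < 1 ->
    0 < hker c u + k * complex.Re (inner c u).
Proof.
move=> c0 c1; have t0 : 0 < enorm c.
  by rewrite lt_def enorm_ge0 andbT -sqrf_eq0 enormE nsq_eq0.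
have t1 : enorm c < 1 by rewrite enorm_lt1.
exists ((ln (1 + enorm c) - ln (1 - enorm c)) / enorm c) => u u1.
rewrite /hker -[nsq c]enormE; have [+ +] := andP (Re_inner_bound c u).
have := cmod2_den_gt0 c1 u1; move: u1; rewrite -enorm_lt1 /cmod2.
move: (enorm_ge0 u); rewrite cReD cReN /=.
move: (enorm u) (enorm c) (complex.Re (inner c u)) (complex.Im _) t0 t1.
move=> s t y v t0 t1 s0 s1 den0 y0 y1.
have ty : t * (y / t) = y by rewrite mulrC divfK // gt_eqF.
have x1 : y / t < 1 by rewrite ltr_pdivrMr //; nra.
have x0 : -1 < y / t by rewrite ltr_pdivlMr //; nra.
have y2 : 0 < 1 - y by nra.
have h := @ln_chord _ t (y / t).
have := h _ _; rewrite t0 t1 x0 x1 ty => /(_ isT isT) {}h.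
have -> : 1 - t ^+ 2 = (1 - t) * (1 + t) by ring.
rewrite lnM ?posrE; [|lra..].
have h2 : 2 * ln (1 - y) <= ln ((1 - y) ^+ 2 + v ^+ 2).
  have -> : 2 * ln (1 - y) = ln ((1 - y) ^+ 2) by rewrite lnXn // mulr_natl.
  by rewrite ler_ln ?posrE ?exprn_gt0 // lerDl sqr_ge0.
by rewrite -mulrA [t^-1 * y]mulrC; nra.
Qed.

(** The first logarithm is at most -2 t Re <e, u> + t^2 |<e, u>|^2 by [ln_le_subr1]. The second
    contributes at most 2 t^2, because t <= 1/2 keeps 1 - t^2 |e|^2 above 3/4. *)
Lemma hker_scale_le e u (t : R) : nsq e <= 1 -> nsq u < 1 -> 0 < t <= 1 / 2 ->
  hker (t%:C *: e) u <= - (2 * t * complex.Re (inner e u)) + 3 * t ^+ 2.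
Proof.
move=> e1 u1 /andP[t0 t1]; rewrite /hker nsqZ cmod2C innerZl.
have te1 : nsq (t%:C *: e) < 1 by rewrite nsqZ cmod2C; have := nsq_ge0 e; nra.
have := cmod2_den_gt0 te1 u1; rewrite innerZl => den0.
have := ln_le_subr1 den0.
rewrite /cmod2 cReD cImD cReN cImN cReM cImM /= !mul0r subr0 addr0.
have h : cmod2 (inner e u) <= 1.
  apply: le_trans (cauchy_schwarz e u) _.
  by have := nsq_ge0 e; have := nsq_ge0 u; nra.
have s0 : 0 <= t ^+ 2 * nsq e by rewrite mulr_ge0 ?sqr_ge0 ?nsq_ge0.
have s1 : t ^+ 2 * nsq e <= t ^+ 2 by rewrite ler_piMr ?sqr_ge0.
have s2 : t ^+ 2 <= 1 / 4 by nra.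
have : - ln (1 - t ^+ 2 * nsq e) <= 2 * t ^+ 2.
  have := @lnB_le R 1 (1 - t ^+ 2 * nsq e) ltr01 _.
  rewrite ln1 sub0r => /(_ _)/le_trans; apply; first lra.
  by rewrite ler_pdivrMr; nra.
move: h; rewrite /cmod2; move: (complex.Re _) (complex.Im _) => x y h.
have : t ^+ 2 * (x ^+ 2 + y ^+ 2) <= t ^+ 2 by rewrite ler_piMr ?sqr_ge0.
nra.
Qed.

(** The constant does not depend on [w], so the bound survives integration over [w]. *)
Lemma hker_lipschitz (d : R) z z' w : 0 < d -> nsq z <= 1 - d ->
  nsq z' <= 1 - d -> nsq w < 1 ->
  hker z w - hker z' w <= (24 / d ^+ 2 + 2 / d) * enorm (z - z').
Proof.
move=> d0 zd z'd w1.
have z1 : nsq z < 1 by lra.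
have z'1 : nsq z' < 1 by lra.
have den := cmod2_den_gt0 z1 w1; have den' := cmod2_den_gt0 z'1 w1.
have D0 : d / 2 * (d / 2) <= cmod2 (1 - inner z' w).
  by rewrite -expr2; apply: cmod2_den_ge_sqr => //; exact: ltW.
have e0 := enorm_ge0 (z - z').
have ez : enorm z < 1 by rewrite enorm_lt1.
have ez' : enorm z' < 1 by rewrite enorm_lt1.
have ew : enorm w < 1 by rewrite enorm_lt1.
have := enorm_ge0 z; have := enorm_ge0 z'; have := enorm_ge0 w => w0 z'0 z0.
have /andP[Rz1 Rz2] := Re_inner_bound z w.
have /andP[Rz'1 Rz'2] := Re_inner_bound z' w.
have /andP[Iz1 Iz2] := Im_inner_bound z w.
have /andP[Iz'1 Iz'2] := Im_inner_bound z' w.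
have /andP[Rd1 Rd2] := Re_inner_bound (z - z') w.
have /andP[Id1 Id2] := Im_inner_bound (z - z') w.
move: Rd1 Rd2 Id1 Id2; rewrite innerBl cReD cReN cImD cImN => Rd1 Rd2 Id1 Id2.
have zw : enorm z * enorm w <= 1 by nra.
have z'w : enorm z' * enorm w <= 1 by nra.
have dw : enorm (z - z') * enorm w <= enorm (z - z') by nra.
(* The squared moduli differ by at most 6 |z - z'| and are at least d^2 / 4, whence 24 / d^2. *)
have h1 : ln (cmod2 (1 - inner z w)) - ln (cmod2 (1 - inner z' w)) <=
    24 / d ^+ 2 * enorm (z - z').
  apply: le_trans (lnB_le den den') _; rewrite ler_pdivrMr //.
  have : cmod2 (1 - inner z w) - cmod2 (1 - inner z' w) <= 6 * enorm (z - z').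
    rewrite /cmod2 !cReD !cImD !cReN !cImN /=.
    set x := complex.Re (inner z w) in Rz1 Rz2 Rd1 Rd2 *.
    set y := complex.Im (inner z w) in Iz1 Iz2 Id1 Id2 *.
    set x' := complex.Re (inner z' w) in Rz'1 Rz'2 Rd1 Rd2 *.
    set y' := complex.Im (inner z' w) in Iz'1 Iz'2 Id1 Id2 *.
    have k1 : (x' - x) * (2 - x - x') <= enorm (z - z') * 4.
      have k0 : 0 <= 2 - x - x' by lra.
      apply: (@le_trans _ _ (enorm (z - z') * (2 - x - x'))).
        by apply: ler_wpM2r => //; lra.
      by apply: ler_wpM2l => //; lra.
    have k2 : (y - y') * (y + y') <= enorm (z - z') * 2.
      apply: le_trans (ler_norm _) _; rewrite normrM; apply: ler_pM => //.
        by rewrite ler_norml; apply/andP; split; lra.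
      by rewrite ler_norml; apply/andP; split; lra.
    lra.
  move/le_trans; apply.
  have -> : 6 * enorm (z - z') =
      24 / d ^+ 2 * enorm (z - z') * (d / 2 * (d / 2)).
    by field; rewrite gt_eqF.
  apply: ler_wpM2l => //.
  by rewrite mulr_ge0 // divr_ge0 // sqr_ge0.
have h2 : ln (1 - nsq z') - ln (1 - nsq z) <= 2 / d * enorm (z - z').
  apply: le_trans (lnB_le _ _) _; [lra..|].
  (* This is |z|^2 - |z'|^2 = Re <z - z', z + z'>. *)
  have -> : 1 - nsq z' - (1 - nsq z) =
      complex.Re (inner (z - z') z) + complex.Re (inner (z - z') z').
    by rewrite !innerBl !cReD !cReN !innerE /= (innerC z' z) cReJ; ring.
  have /andP[_ k1] := Re_inner_bound (z - z') z.
  have /andP[_ k2] := Re_inner_bound (z - z') z'.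
  rewrite ler_pdivrMr; last lra.
  have : 2 / d * enorm (z - z') * d <= 2 / d * enorm (z - z') * (1 - nsq z).
    apply: ler_wpM2l; last lra.
    by rewrite mulr_ge0 // divr_ge0 // ltW.
  apply: le_trans.
  have -> : 2 / d * enorm (z - z') * d = 2 * enorm (z - z').
    by field; rewrite gt_eqF.
  nra.
rewrite /hker; lra.
Qed.

(** A bound for every [w], from |1 - <z, w>| >= (1 - |z|^2) / 2; it tends to -oo as [z] nears the
    boundary. *)
Lemma hker_lower z w : nsq z < 1 -> nsq w < 1 ->
  ln (1 - nsq z) - ln 4 <= hker z w.
Proof.
move=> z1 w1; have z0 : 0 < 1 - nsq z by rewrite subr_gt0.
have := @cmod2_den_ge_sqr _ _ z w (1 - nsq z) (ltW z0) _ z1 w1.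
rewrite opprB addrC subrK lexx => /(_ isT) h.
rewrite /hker lerBrDr.
have -> : ln (1 - nsq z) - ln 4 + ln (1 - nsq z) = ln (((1 - nsq z) / 2) ^+ 2).
  rewrite expr_div_n ln_div ?posrE ?exprn_gt0 // lnXn //.
  by rewrite -natrX; ring.
by rewrite ler_ln ?posrE ?exprn_gt0 ?cmod2_den_gt0 // divr_gt0.
Qed.

(** For [w] in a fixed smaller ball the bound tends to +oo as [z] nears the boundary; [psi_coercive]
    weighs it against [hker_lower]. *)
Lemma hker_lower_inner z w (d : R) : nsq z < 1 -> 0 < d -> nsq w <= 1 - d ->
  ln ((d / 2) ^+ 2) - ln (1 - nsq z) <= hker z w.
Proof.
move=> z1 d0 wd; have w1 : nsq w < 1 by lra.
rewrite /hker lerD2r ler_ln ?posrE ?exprn_gt0 ?cmod2_den_gt0 ?divr_gt0 //.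
by rewrite cmod2_denC cmod2_den_ge_sqr // ltW.
Qed.

Lemma hker_upper z w : nsq z < 1 -> nsq w < 1 ->
  hker z w <= ln 4 - ln (1 - nsq z).
Proof.
move=> z1 w1; rewrite /hker lerD2r ler_ln ?posrE ?cmod2_den_gt0 //.
exact: cmod2_den_le4.
Qed.

End LogKernel.

(** * Minima over closed subballs *)

Section MinimumOnBall.
Context {R : realType} {m : nat}.
Implicit Types v : 'rV[R]_(m + m).

(** Real coordinates on C^m, through which compactness of boxes in R^(2m) becomes available. *)
Definition cvec v : 'cV[R[i]]_m :=
  \col_k Complex (v 0 (lshift m k)) (v 0 (rshift m k)).

Lemma cvecB v v' : cvec (v - v') = cvec v - cvec v'.
Proof. by apply/colP => k; rewrite !mxE. Qed.

Lemma cvec_surj (z : 'cV[R[i]]_m) : exists v, cvec v = z.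
Proof.
exists (row_mx (\row_k complex.Re (z k 0)) (\row_k complex.Im (z k 0))).
by apply/colP => k; rewrite mxE row_mxEl row_mxEr !mxE; case: (z k 0).
Qed.

Lemma nsq_cvecE v :
  nsq (cvec v) = \sum_k (v 0 (lshift m k) ^+ 2 + v 0 (rshift m k) ^+ 2).
Proof. by apply: eq_bigr => k _; rewrite mxE. Qed.

Lemma continuous_nsq_cvecB v0 : continuous (fun v => nsq (cvec (v - v0))).
Proof.
under [X in continuous X]eq_fun do rewrite nsq_cvecE.
apply: continuous_big => [|k _ v]; first exact: add_continuous.
have sq (x c : R) : {for x, continuous (fun x => (x - c) ^+ 2)}.
  apply: (@continuous_comp _ _ _ (fun x => x - c) (fun x => x ^+ 2)).
    by apply: cvgB; [exact: cvg_id | exact: cvg_cst].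
  exact: exprn_continuous.
have sqj j : {for v, continuous (fun v => (v - v0) 0 j ^+ 2)}.
  rewrite (_ : (fun v => _) = (fun v => (v 0 j - v0 0 j) ^+ 2)); last first.
    by apply/funext => u; rewrite !mxE.
  exact: (continuous_comp (@coord_continuous R _ _ 0 j v) (sq _ (v0 0 j))).
exact: cvgD (sqj _) (sqj _).
Qed.

Lemma compact_cvec_ball (r : R) : r <= 1 -> compact [set v | nsq (cvec v) <= r].
Proof.
move=> r1; have bc := @rV_compact R (m + m)
  (fun=> `[(-1 : R), 1]%classic) (fun=> @segment_compact _ _ _).
apply: subclosed_compact bc _.
  apply: (preimage_closed (D := [set x : R | x <= r])); last exact: closed_le.
  move=> v _.
    have := @continuous_nsq_cvecB 0 v.
    by under [X in continuous_at v X -> _]eq_fun do rewrite subr0.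
move=> v /= vr j; rewrite /= in_itv /=.
suff : v 0 j ^+ 2 <= 1 by move=> h; apply: sqr_le_absP => //; rewrite expr1n.
apply: le_trans r1; apply: le_trans vr; rewrite nsq_cvecE.
case: (split_ordP j) => k ->; rewrite (bigD1 k) //= -?addrA ?lerDl.
- by rewrite addr_ge0 ?sqr_ge0 ?sumr_ge0 // => *; rewrite addr_ge0 ?sqr_ge0.
- rewrite addrCA lerDl.
  by rewrite addr_ge0 ?sqr_ge0 ?sumr_ge0 // => *; rewrite addr_ge0 ?sqr_ge0.
Qed.

Lemma lipschitz_min (f : 'cV[R[i]]_m -> R) (r C : R) : 0 <= r <= 1 ->
  (forall z z', nsq z <= r -> nsq z' <= r ->
     f z - f z' <= C * enorm (z - z')) ->
  exists2 a, nsq a <= r & forall z, nsq z <= r -> f a <= f z.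
Proof.
move=> /andP[r0 r1] fC; set A := [set v | nsq (cvec v) <= r].
have A0 : A !=set0.
  by have [v v0] := cvec_surj 0; exists v; rewrite /A /= v0 nsq0.
have [|v Av vmin] :=
  @compact_EVT_min _ R (f \o cvec) A A0 (compact_cvec_ball r1).
  apply/subspace_continuousP => v Av; apply/cvgrPdist_lt => e e0.
  (* A positive bound for [C], whose sign is arbitrary. *)
  pose D : R := `|C| + 1.
  have D0 : 0 < D by rewrite ltr_wpDl.
  have near_small : \forall v' \near v, nsq (cvec (v' - v)) < (e / D) ^+ 2.
    have /cvgrPdist_lt := @continuous_nsq_cvecB v v.
    move=> /(_ ((e / D) ^+ 2)); rewrite exprn_gt0 ?divr_gt0 //.
    move=> /(_ isT); apply: filterS => v'; rewrite subrr.
    have -> : cvec 0 = 0 by apply/colP => k; rewrite !mxE.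
    by rewrite nsq0 sub0r normrN ger0_norm // nsq_ge0.
  rewrite near_withinE; near=> v' => Av' /=.
  have : nsq (cvec (v' - v)) < (e / D) ^+ 2 by near: v'.
  rewrite -enormE cvecB.
  rewrite ltr_sqr ?nnegrE ?enorm_ge0 ?divr_ge0 ?(ltW e0) ?(ltW D0) //.
  rewrite ltr_pdivlMr // mulrC => lte; apply: le_lt_trans lte.
  have CD : C * enorm (cvec v' - cvec v) <= D * enorm (cvec v' - cvec v).
    rewrite ler_wpM2r ?enorm_ge0 // (le_trans (ler_norm C)) // lerDl.
    exact: ler01.
  have sym : enorm (cvec v - cvec v') = enorm (cvec v' - cvec v).
    rewrite -opprB /enorm; congr (Num.sqrt (complex.Re _)).
    by rewrite -scaleN1r innerZl innerZr rmorphN rmorph1 mulN1r mulN1r opprK.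
  rewrite ler_norml; apply/andP; split.
    rewrite lerNl opprB; apply: le_trans CD; exact: fC.
  by apply: le_trans CD; rewrite -sym; exact: fC.
exists (cvec v); first by move: Av; rewrite inE.
move=> z; have [v' <-] := cvec_surj z => zr.
by apply: vmin; rewrite inE.
Unshelve. all: by end_near. Qed.

End MinimumOnBall.

(** * Barycenters of finite measures *)

Section ComplexMeasurability.
Context d (T : measurableType d) (R : realType) (D : set T).
Implicit Types f g : T -> R[i].

(** Componentwise, to match [vintegral]. *)
Definition cmeasurable f :=
  measurable_fun D (fun t => complex.Re (f t)) /\
  measurable_fun D (fun t => complex.Im (f t)).

Lemma eq_cmeasurable f g : f =1 g -> cmeasurable f -> cmeasurable g.
Proof. by move=> /funext ->. Qed.

Lemma cmeasurable_cst (x : R[i]) : cmeasurable (fun=> x).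
Proof. by split; exact: measurable_cst. Qed.

Lemma cmeasurableD f g :
  cmeasurable f -> cmeasurable g -> cmeasurable (fun t => f t + g t).
Proof.
move=> [f1 f2] [g1 g2]; split.
- by under eq_fun do rewrite cReD; exact: measurable_funD.
- by under eq_fun do rewrite cImD; exact: measurable_funD.
Qed.

Lemma cmeasurableM f g :
  cmeasurable f -> cmeasurable g -> cmeasurable (fun t => f t * g t).
Proof.
move=> [f1 f2] [g1 g2]; split.
- under eq_fun do rewrite cReM.
  by apply: measurable_funB; exact: measurable_funM.
- under eq_fun do rewrite cImM.
  by apply: measurable_funD; exact: measurable_funM.
Qed.

Lemma cmeasurableN f : cmeasurable f -> cmeasurable (fun t => - f t).
Proof.
move=> /(cmeasurableM (cmeasurable_cst (-1))); apply: eq_cmeasurable => t.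
by rewrite mulN1r.
Qed.

Lemma cmeasurableJ f : cmeasurable f -> cmeasurable (fun t => (f t)^*).
Proof.
move=> [f1 f2]; split.
- by under eq_fun do rewrite cReJ.
- by under eq_fun do rewrite cImJ; exact: measurable_funN.
Qed.

Lemma cmeasurable_sum n (f : 'I_n -> T -> R[i]) :
  (forall k, cmeasurable (f k)) -> cmeasurable (fun t => \sum_k f k t).
Proof.
move=> mf; elim: n f mf => [|n IH] f mf.
  apply: (eq_cmeasurable _ (cmeasurable_cst 0)) => t.
  by rewrite big_ord0.
apply: (eq_cmeasurable _ (cmeasurableD (mf ord0)
  (IH _ (fun k => mf (lift ord0 k))))) => t.
by rewrite big_ord_recl.
Qed.

Lemma measurable_cmod2 f :
  cmeasurable f -> measurable_fun D (fun t => cmod2 (f t)).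
Proof.
by move=> [f1 f2]; apply: measurable_funD; exact: measurable_funX.
Qed.

Lemma cmeasurableV f : (forall t, f t != 0) -> cmeasurable f ->
  cmeasurable (fun t => (f t)^-1).
Proof.
move=> f0 mf; have m2 : measurable_fun D (fun t => (cmod2 (f t))^-1).
  (* As [cmod2 (f t)] is positive, its inverse is a composition of the measurable functions [expR]
     and [ln]. *)
  rewrite (_ : (fun _ => _) = (fun t => expR (- ln (cmod2 (f t))))); last first.
    apply/funext => t; rewrite expRN lnK // posrE lt_def cmod2_ge0 andbT.
    by rewrite cmod2_eq0.
  apply: measurableT_comp => //; apply: measurable_funN.
  by apply: measurableT_comp => //; exact: measurable_cmod2.
case: mf => f1 f2; split.
- under eq_fun do rewrite cReV.
  exact: measurable_funM.
- under eq_fun do rewrite cImV.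
  by apply: measurable_funN; exact: measurable_funM.
Qed.

End ComplexMeasurability.

Section Rintegral_aux.
Context d (T : measurableType d) (R : realType).
Variables (nu : {measure set T -> \bar R}) (D : set T).
Hypothesis mD : measurable D.

(** If the integral were zero, [f] would vanish almost everywhere on [D], and [D] would lie in a
    null set. *)
Lemma Rintegral_gt0 (f : T -> R) : nu.-integrable D (EFin \o f) ->
  (forall t, D t -> 0 < f t) -> (0 < nu D)%E -> 0 < \int[nu]_(t in D) f t.
Proof.
move=> fi f0 D0; rewrite lt_def Rintegral_ge0 ?andbT => [|t /f0/ltW//].
apply/eqP => i0.
have i0' : (\int[nu]_(t in D) (f t)%:E = 0)%E.
  by rewrite -(fineK (integrable_fin_num mD fi)); congr EFin.
have : (\int[nu]_(t in D) `|(EFin \o f) t| = 0)%E.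
  rewrite -i0'; apply: eq_integral => t /set_mem Dt.
  by rewrite /= ger0_norm // ltW // f0.
move=> /(ae_eq_integral_abs _ mD (measurable_int _ fi)) [N [mN N0 sub]].
suff : (nu D <= nu N)%E by rewrite N0 leNgt D0.
apply: le_measure; rewrite ?inE // => t Dt; apply: sub => /(_ Dt) [ft0].
by have := f0 _ Dt; rewrite ft0 ltxx.
Qed.

Lemma Rintegral_sum n (f : 'I_n -> T -> R) :
  (forall k, nu.-integrable D (EFin \o f k)) ->
  \int[nu]_(t in D) (\sum_k f k t) = \sum_k \int[nu]_(t in D) f k t.
Proof.
move=> fi; rewrite /Rintegral.
under eq_integral do rewrite -sumEFin.
rewrite integral_sum //= sum_fine // => k _.
exact: integrable_fin_num (fi k).
Qed.

End Rintegral_aux.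

Section Barycenter.
Context d (T : measurableType d) (R : realType) (m : nat).
Variables (nu : {measure set T -> \bar R}) (D : set T) (X : T -> 'cV[R[i]]_m).
Hypothesis mD : measurable D.
Hypothesis D_gt0 : (0 < nu D)%E.
Hypothesis D_fin : (nu D < +oo)%E.
Hypothesis X_ball : forall t, nsq (X t) < 1.
Hypothesis mX : forall k, cmeasurable D (fun t => X t k 0).
Implicit Types a b c e z : 'cV[R[i]]_m.

(** * Measurability and integrability of the integrands *)

Lemma cmeasurable_inner z : cmeasurable D (fun t => inner z (X t)).
Proof.
apply: cmeasurable_sum => k; apply: cmeasurableM; first exact: cmeasurable_cst.
exact: cmeasurableJ.
Qed.

Lemma cmeasurable_inner_l a : cmeasurable D (fun t => inner (X t) a).
Proof.
apply: (eq_cmeasurable _ (cmeasurableJ (cmeasurable_inner a))).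
by move=> t; rewrite [RHS]innerC.
Qed.

Lemma cmeasurable_den a : cmeasurable D (fun t => 1 - inner (X t) a).
Proof.
apply: cmeasurableD; first exact: cmeasurable_cst.
exact: cmeasurableN (cmeasurable_inner_l a).
Qed.

Lemma cmeasurable_projP a k : cmeasurable D (fun t => projP a (X t) k 0).
Proof.
rewrite /projP; case: (a == 0).
  apply: (@eq_cmeasurable _ _ R D (fun=> 0)) => [t|]; last first.
    exact: cmeasurable_cst.
  by rewrite mxE.
apply: (eq_cmeasurable _ (cmeasurableM (cmeasurable_inner_l a)
  (cmeasurable_cst _ ((inner a a)^-1 * a k 0)))) => t.
by rewrite mxE mulrA.
Qed.

Lemma cmeasurable_p a k : nsq a < 1 -> cmeasurable D (fun t => p_ a (X t) k 0).
Proof.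
move=> a1.
have mQ : cmeasurable D (fun t => projQ a (X t) k 0).
  apply: (eq_cmeasurable _ (cmeasurableD (mX k)
    (cmeasurableN (cmeasurable_projP a k)))) => t.
  by rewrite /projQ !mxE.
apply: (eq_cmeasurable _ (cmeasurableM
  (cmeasurableV _ (cmeasurable_den a))
  (cmeasurableD (cmeasurableD (cmeasurable_cst _ (a k 0))
     (cmeasurableN (cmeasurable_projP a k)))
     (cmeasurableN (cmeasurableM (cmeasurable_cst _ (s_ a)%:C) mQ))))).
  by move=> t; rewrite p_E /pnum !mxE.
by move=> t; exact: den_neq0.
Qed.

Lemma bounded_integrable (f : T -> R) (M : R) : measurable_fun D f ->
  (forall t, `|f t| <= M) -> nu.-integrable D (EFin \o f).
Proof.
move=> mf fM; apply: measurable_bounded_integrable => //.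
exists M; split; first exact: num_real.
by move=> x Mx t _; exact: le_trans (ltW Mx).
Qed.

Lemma integrable_hker z : nsq z < 1 ->
  nu.-integrable D (EFin \o (fun t => hker z (X t))).
Proof.
(* The bounds in [hker_lower] and [hker_upper] are opposite numbers. *)
move=> z1; apply: (@bounded_integrable _ (ln 4 + (- ln (1 - nsq z)))).
  apply: measurable_funB; last exact: measurable_cst.
  apply: measurableT_comp; first exact: measurable_ln.
  under eq_fun do rewrite -cmod2_denC.
  exact: measurable_cmod2 (cmeasurable_den z).
move=> t; rewrite ler_norml hker_upper ?X_ball // andbT opprB.
by rewrite hker_lower.
Qed.

Lemma integrable_p a k : nsq a < 1 ->
  nu.-integrable D (EFin \o (fun t => complex.Re (p_ a (X t) k 0))) /\
  nu.-integrable D (EFin \o (fun t => complex.Im (p_ a (X t) k 0))).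
Proof.
move=> a1; have [m1 m2] := cmeasurable_p k a1.
have le1 (x : R) t : x ^+ 2 <= cmod2 (p_ a (X t) k 0) -> `|x| <= 1.
  move=> h; rewrite ler_norml; apply: sqr_le_absP => //; rewrite expr1n.
  apply: le_trans h _; apply: le_trans (cmod2_coord_le _ k) _.
  by apply: ltW; apply: p_in_ball.
split; apply: (@bounded_integrable _ 1) => // t; apply: le1.
- exact: sqr_Re_le.
- exact: sqr_Im_le.
Qed.

Lemma Re_innerE c z : complex.Re (inner c z) =
  \sum_k (complex.Re (c k 0) * complex.Re (z k 0) +
          complex.Im (c k 0) * complex.Im (z k 0)).
Proof.
rewrite /inner cRe_sum; apply: eq_bigr => k _.
by rewrite cReM cReJ cImJ mulrN opprK.
Qed.

Lemma integrable_Re_inner_p a c : nsq a < 1 ->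
  nu.-integrable D (EFin \o (fun t => complex.Re (inner c (p_ a (X t))))).
Proof.
move=> a1; apply: (@bounded_integrable _ (enorm c)).
  under eq_fun do rewrite Re_innerE.
  apply: measurable_sum => k; have [m1 m2] := cmeasurable_p k a1.
  by apply: measurable_funD; apply: measurable_funM => //;
    exact: measurable_cst.
move=> t; have u1 := p_in_ball a1 (X_ball t).
have := Re_inner_bound c (p_ a (X t)); rewrite -ler_norml => /le_trans; apply.
by rewrite ler_piMr ?enorm_ge0 // ltW // enorm_lt1.
Qed.

(** * Barycentric points and real linear forms *)

Definition barycentric a :=
  vintegral nu D (fun t => p_ a (X t)) = 0.

Lemma barycentricE a : barycentric a <-> forall k,
  \int[nu]_(t in D) complex.Re (p_ a (X t) k 0) = 0 /\
  \int[nu]_(t in D) complex.Im (p_ a (X t) k 0) = 0.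
Proof.
rewrite /barycentric; split=> [h k|h].
  by have := congr1 (fun v : 'cV[R[i]]_m => v k 0) h; rewrite !mxE => -[].
by apply/colP => k; rewrite !mxE; have [-> ->] := h k.
Qed.

Lemma barycentric_inner a c : nsq a < 1 -> barycentric a ->
  \int[nu]_(t in D) complex.Re (inner c (p_ a (X t))) = 0.
Proof.
move=> a1 /barycentricE h.
under eq_Rintegral do rewrite Re_innerE.
rewrite Rintegral_sum //=.
  apply: big1 => k _; have [i1 i2] := integrable_p k a1; have [h1 h2] := h k.
  rewrite RintegralD //= ?RintegralZl // ?h1 ?h2 ?mulr0 ?addr0 //.
    exact: (integrableZl mD (complex.Re (c k 0)) i1).
  exact: (integrableZl mD (complex.Im (c k 0)) i2).
move=> k; have [i1 i2] := integrable_p k a1.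
exact: (integrableD mD (integrableZl mD (complex.Re (c k 0)) i1)
          (integrableZl mD (complex.Im (c k 0)) i2)).
Qed.

(** A one-sided inequality suffices since [e] may be replaced by [- e]: multiples of the k-th basis
    vector by 1, -1, i and -i isolate both parts of the k-th component. *)
Lemma barycentric_suff a : nsq a < 1 ->
  (forall e, nsq e <= 1 ->
     \int[nu]_(t in D) complex.Re (inner e (p_ a (X t))) <= 0) ->
  barycentric a.
Proof.
move=> a1 h; apply/barycentricE => k; have [i1 i2] := integrable_p k a1.
have key (x : R[i]) : cmod2 x = 1 ->
    complex.Re x * \int[nu]_(t in D) complex.Re (p_ a (X t) k 0) +
    complex.Im x * \int[nu]_(t in D) complex.Im (p_ a (X t) k 0) <= 0.
  move=> x1; have := h (x *: delta_mx k 0); rewrite nsqZ x1 mul1r.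
  have -> : nsq (delta_mx k 0 : 'cV[R[i]]_m) = 1.
    rewrite /nsq (bigD1 k) //= big1 => [|j jk].
      by rewrite mxE !eqxx /= cmod2C expr1n addr0.
    by rewrite mxE (negbTE jk) /= cmod2C expr0n.
  move=> /(_ (lexx _)); apply: le_trans; rewrite le_eqVlt; apply/orP; left.
  apply/eqP; rewrite -!RintegralZl // -RintegralD //=; last first.
  - exact: (integrableZl mD (complex.Im x) i2).
  - exact: (integrableZl mD (complex.Re x) i1).
  apply: eq_Rintegral => t _; rewrite innerZl /inner (bigD1 k) //= big1.
    rewrite addr0 [delta_mx _ _ _ _]mxE !eqxx mul1r.
    by rewrite cReM cReJ cImJ mulrN opprK.
  by move=> j jk; rewrite [delta_mx _ _ _ _]mxE (negbTE jk) mul0r.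
have := key (Complex 1 0); have := key (Complex (-1) 0).
have := key (Complex 0 1); have := key (Complex 0 (-1)).
rewrite /cmod2 /= !expr0n /= !sqrrN !expr1n !addr0 !add0r.
move=> /(_ erefl) k1 /(_ erefl) k2 /(_ erefl) k3 /(_ erefl) k4.
by split; lra.
Qed.

(* [L_] with the possibly infinite constant [- \int ln (1 - |w|^2)] removed. *)
Definition psi z : R := \int[nu]_(t in D) hker z (X t).

Lemma psiB z z' : nsq z < 1 -> nsq z' < 1 ->
  psi z - psi z' = \int[nu]_(t in D) (hker z (X t) - hker z' (X t)).
Proof. by move=> z1 z'1; rewrite RintegralB //; exact: integrable_hker. Qed.

Let mass : R := fine (nu D).

Let massE : nu D = mass%:E.
Proof. by rewrite fineK // ge0_fin_numE. Qed.

Let mass_gt0 : 0 < mass.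
Proof. by rewrite -lte_fin -massE. Qed.

Lemma Rintegral_const (x : R) : \int[nu]_(_ in D) x = x * mass.
Proof. by rewrite Rintegral_cst. Qed.

Lemma integrable_const (x : R) : nu.-integrable D (EFin \o (fun=> x)).
Proof. by apply: (@bounded_integrable _ `|x|). Qed.

Lemma barycentric_psi_lt a b : nsq a < 1 -> nsq b < 1 -> barycentric a ->
  b != a -> psi a < psi b.
Proof.
move=> a1 b1 bary ba; rewrite -subr_gt0 psiB //.
have c0 : p_ a b != 0 by apply: contra ba => /eqP/(p_eq0 a1 b1) ->.
have [k kP] := hker_gt_linear c0 (p_in_ball a1 b1).
have iR := integrable_Re_inner_p (p_ a b) a1.
have iH : nu.-integrable D (EFin \o (fun t => hker b (X t) - hker a (X t))).
  exact: (integrableB mD (integrable_hker b1) (integrable_hker a1)).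
(* The added linear term has integral zero because [a] is barycentric, and it makes the integrand
   positive pointwise. *)
have : 0 < \int[nu]_(t in D) ((hker b (X t) - hker a (X t)) +
     k * complex.Re (inner (p_ a b) (p_ a (X t)))).
  apply: Rintegral_gt0 => // [|t _].
    exact: (integrableD mD iH (integrableZl mD k iR)).
  by rewrite hker_p_r //; apply: kP; exact: p_in_ball.
rewrite RintegralD //; last exact: (integrableZl mD k iR).
by rewrite RintegralZl // barycentric_inner // mulr0 addr0.
Qed.

Lemma psi0 : psi 0 = 0.
Proof.
rewrite /psi; under eq_Rintegral do rewrite hker0.
by rewrite Rintegral_const mul0r.
Qed.

(** * Growth of [psi] at the boundary and existence of a minimum *)

Let inner_shell (n : nat) : set T :=
  D `&` [set t | nsq (X t) <= 1 - n.+1%:R^-1].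

Let measurable_inner_shell n : measurable (inner_shell n).
Proof.
have mS : measurable_fun D (fun t => nsq (X t)).
  by apply: measurable_sum => k; exact: measurable_cmod2.
rewrite (_ : inner_shell n =
  D `&` (fun t => nsq (X t)) @^-1` `]-oo, 1 - n.+1%:R^-1]%classic).
  exact: mS.
by apply/seteqP; split=> t [Dt /= h]; split => //=; move: h; rewrite in_itv.
Qed.

(** Continuity from below: the sets increase to [D] since each [X t] lies in the open ball. The
    fraction 3/4 exceeds 1/2, so that in [psi_coercive] the gain on this set outweighs the loss off
    it. *)
Let inner_shell_mass : exists n, 3 / 4 * mass <= fine (nu (inner_shell n)).
Proof.
have nd : nondecreasing_seq inner_shell.
  move=> p q pq; apply/subsetPset => t [Dt /= h]; split => //=.
  apply: le_trans h _; rewrite lerD2l lerN2 lef_pV2 ?posrE //.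
  by rewrite ler_nat.
have UD : \bigcup_n inner_shell n = D.
  apply/seteqP; split=> [t [n _ []]//|t Dt].
  have [n nP] := ltr_add_invr (X_ball t).
  by exists n => //; split => //=; rewrite lerBrDr ltW.
have := @nondecreasing_cvg_mu _ _ _ nu inner_shell measurable_inner_shell.
rewrite UD => /(_ mD nd) cv.
have ndnu : nondecreasing_seq (nu \o inner_shell).
  move=> p q /nd/subsetPset pq; apply: le_measure; rewrite ?inE //.
have : (\forall n \near \oo, (3 / 4 * mass)%:E <= (nu \o inner_shell) n)%E.
  apply: lte_lim => //; first by apply/cvg_ex; eexists; exact: cv.
  by rewrite (cvg_lim _ cv) // massE lte_fin; have := mass_gt0; lra.
case=> n _ /(_ n (leqnn n)) /= h; exists n.
rewrite -lee_fin fineK // ge0_fin_numE //; apply: le_lt_trans D_fin.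
by apply: le_measure; rewrite ?inE // => t [].
Qed.

Lemma psi_coercive :
  exists2 r : R, 0 < r < 1 & forall z, nsq z < 1 -> 1 - r < nsq z -> 0 < psi z.
Proof.
have [n nP] := inner_shell_mass.
set G := inner_shell n in nP; set d0 : R := n.+1%:R^-1.
have d00 : 0 < d0 by rewrite invr_gt0.
have d01 : d0 <= 1 by rewrite invf_le1 // ler1n.
have iG : nu.-integrable D (EFin \o \1_G).
  apply: (@bounded_integrable _ 1) => [|t].
    by apply: measurable_indic; exact: measurable_inner_shell.
  by rewrite indicE; case: (_ \in _); rewrite ?normr1 ?normr0.
have intG : \int[nu]_(t in D) \1_G t = fine (nu G).
  rewrite /Rintegral integral_indic //; last exact: measurable_inner_shell.
  congr (fine (nu _)).
  by apply/setIidPl => t [].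
set al := ln ((d0 / 2) ^+ 2) : R.
have al0 : al <= 0.
  by apply: ln_le0; rewrite expr2; nra.
have l4 : 0 < ln (4 : R) by apply: ln_gt0; rewrite ltr1n.
(* This radius makes [l < 2 * (al - ln 4)], which is what the final estimate psi z >= mass (al - ln
   4 - l / 2) requires. *)
exists (expR (2 * (al - ln 4))).
  by rewrite expR_gt0 expR_lt1; lra.
move=> z z1 rz; set l := ln (1 - nsq z).
have lsmall : l < 2 * (al - ln 4).
  rewrite -ltr_expR /l lnK ?posrE ?subr_gt0 //; lra.
(* A two-valued minorant: on [G] it is at most the bound of [hker_lower_inner], off [G] at most that
   of [hker_lower], as [al <= 0 < ln 4]. *)
have : \int[nu]_(t in D) ((al - ln 4 + l) + (- 2 * l) * \1_G t) <= psi z.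
  apply: le_Rintegral => //.
  - exact: (integrableD mD (integrable_const (al - ln 4 + l))
             (integrableZl mD (- 2 * l) iG)).
  - exact: integrable_hker.
  - move=> t Dt; rewrite indicE.
    case: (boolP (t \in G)) => [/set_mem [_ /= h]|_] /=.
      have := hker_lower_inner z1 d00 h; rewrite -/al -/l; lra.
    have := hker_lower z1 (X_ball t); rewrite -/l; lra.
apply: lt_le_trans; rewrite RintegralD //.
- rewrite Rintegral_const RintegralZl // intG.
  have := mass_gt0; nra.
- exact: integrable_const.
- exact: (integrableZl mD (- 2 * l) iG).
Qed.

(** The minimum over the closed subball is global: outside it [psi] is positive, while inside it
    takes the value 0 at the origin. *)
Lemma exists_psi_min :
  exists2 a, nsq a < 1 & forall z, nsq z < 1 -> psi a <= psi z.
Proof.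
have [r /andP[r0 r1] rP] := psi_coercive.
have [|z z' zr z'r|a ar amin] :=
  @lipschitz_min R m psi (1 - r) ((24 / r ^+ 2 + 2 / r) * mass).
- by apply/andP; split; lra.
- rewrite psiB; [|lra..].
  rewrite mulrAC -Rintegral_const; apply: le_Rintegral => //.
  + have z1 : nsq z < 1 by lra.
    have z'1 : nsq z' < 1 by lra.
    exact: (integrableB mD (integrable_hker z1) (integrable_hker z'1)).
  + exact: integrable_const.
  + by move=> t _; exact: hker_lipschitz.
exists a; first lra.
move=> z z1; have [zr|zr] := leP (nsq z) (1 - r); first exact: amin.
apply: (@le_trans _ _ 0); last by rewrite ltW // rP.
rewrite -psi0; apply: amin.
by rewrite nsq0; lra.
Qed.

(** Minimality is tested at the points [p_ a (t%:C *: e)]; a positive integral [I] contradicts the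
    expansion in [t]. *)
Lemma psi_min_barycentric a : nsq a < 1 ->
  (forall z, nsq z < 1 -> psi a <= psi z) -> barycentric a.
Proof.
move=> a1 amin; apply: barycentric_suff => // e e1.
set I := Rintegral _ _ _; rewrite leNgt; apply/negP => I0.
have iR := integrable_Re_inner_p e a1.
have key t : 0 < t <= 1 / 2 -> 0 <= - (2 * t) * I + 3 * t ^+ 2 * mass.
  move=> /[dup] /andP[t0 t1] t01.
  have c1 : nsq (t%:C *: e) < 1 by rewrite nsqZ cmod2C; have := nsq_ge0 e; nra.
  have pc1 := p_in_ball a1 c1; have := amin _ pc1; rewrite -subr_ge0 psiB //.
  move/le_trans; apply; rewrite -Rintegral_const -RintegralZl // -RintegralD //.
  - apply: le_Rintegral => //.
    + exact: (integrableB mD (integrable_hker pc1) (integrable_hker a1)).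
    + exact: (integrableD mD (integrableZl mD (- (2 * t)) iR)
               (integrable_const (3 * t ^+ 2))).
    + move=> s _; rewrite hker_p_l //.
      have := hker_scale_le e1 (p_in_ball a1 (X_ball s)) t01.
      by rewrite mulNr.
  - exact: (integrableZl mD (- (2 * t)) iR).
  - exact: integrable_const.
have M0 := mass_gt0.
(* With 3 t mass <= I, the bound -2 t I + 3 t^2 mass is at most - t I, hence negative. *)
pose t := Num.min (1 / 2) (I / (3 * mass)).
have t0 : 0 < t by rewrite lt_min !divr_gt0 //; lra.
have t1 : t <= 1 / 2 by rewrite ge_min lexx.
have t2 : t * (3 * mass) <= I.
  by rewrite -ler_pdivlMr ?ge_min ?lexx ?orbT //; lra.
by have := key t; rewrite t0 t1 => /(_ isT); nra.
Qed.

(** The function ln (1 - |w|^2) may fail to be integrable, so [psi] cannot simply be shifted by a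
    constant. If the value at [z] is finite, the integrable difference of the two kernels is added
    to it. *)
Lemma le_integral_logker a z : nsq a < 1 -> nsq z < 1 -> psi a <= psi z ->
  (- (\int[nu]_(t in D) (logker a (X t))%:E) <=
   - (\int[nu]_(t in D) (logker z (X t))%:E))%E.
Proof.
move=> a1 z1 az.
(* Negation passes through a possibly infinite integral because the integrand has constant sign. *)
have intN b : nsq b < 1 -> (- (\int[nu]_(t in D) (logker b (X t))%:E) =
    \int[nu]_(t in D) (- logker b (X t))%:E)%E.
  move=> b1; apply: (canLR oppeK); rewrite -integral_ge0N.
    by apply: eq_integral => t _; rewrite -EFinN opprK.
  by move=> t _; rewrite lee_fin oppr_ge0 logker_le0.
rewrite !intN //.
have [->|fin] := eqVneq (\int[nu]_(t in D) (- logker z (X t))%:E)%E +oo%E.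
  by rewrite leey.
have mlog : measurable_fun D (fun t => - logker z (X t)).
  under eq_fun do rewrite logkerE //.
  apply: measurable_funN; apply: measurable_funB; last first.
    by apply/measurable_EFinP; case/integrableP: (integrable_hker z1).
  apply: measurableT_comp; first exact: measurable_ln.
  apply: measurable_funB; first exact: measurable_cst.
  by apply: measurable_sum => k; exact: measurable_cmod2.
have iz : nu.-integrable D (EFin \o (fun t => - logker z (X t))).
  apply/integrableP; split; first exact/measurable_EFinP.
  rewrite (eq_integral (fun t => (- logker z (X t))%:E)) ?ltey // => t _.
  by rewrite /= ger0_norm // oppr_ge0 logker_le0.
have ih := integrableB mD (integrable_hker a1) (integrable_hker z1).
have -> : (\int[nu]_(t in D) (- logker a (X t))%:E =
    \int[nu]_(t in D) ((- logker z (X t))%:E +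
                       (hker a (X t) - hker z (X t))%:E))%E.
  apply: eq_integral => t _; rewrite -EFinD !logkerE //; congr EFin; ring.
rewrite (integralD mD iz ih) -[leRHS]adde0 leeD2l //.
rewrite -(fineK (integrable_fin_num mD ih)) lee_fin -/(Rintegral _ _ _).
by rewrite -psiB // subr_le0.
Qed.

End Barycenter.

(** * Measurability on the ball *)

Section BallMeasurability.
Context {R : realType} {m : nat}.
Implicit Type z : Ball R m.

Lemma continuous_cRe : continuous (@complex.Re R : R[i] -> R).
Proof.
move=> x U /= /(nbhs_ballP (complex.Re x)) [e e0 eU].
apply/nbhs_ballP; exists e%:C => [|y]; first by rewrite /= ltcR.
rewrite -ball_normE /= => h; apply: eU.
rewrite -ball_normE /= -cReN -cReD -ltcR.
apply: le_lt_trans h; rewrite normc_def lecR.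
by rewrite -sqrtr_sqr ler_sqrt ?addr_ge0 ?sqr_ge0 // sqr_Re_le.
Qed.

Lemma continuous_cIm : continuous (@complex.Im R : R[i] -> R).
Proof.
move=> x U /= /(nbhs_ballP (complex.Im x)) [e e0 eU].
apply/nbhs_ballP; exists e%:C => [|y]; first by rewrite /= ltcR.
rewrite -ball_normE /= => h; apply: eU.
rewrite -ball_normE /= -cImN -cImD -ltcR.
apply: le_lt_trans h; rewrite normc_def lecR.
by rewrite -sqrtr_sqr ler_sqrt ?addr_ge0 ?sqr_ge0 // sqr_Im_le.
Qed.

Lemma continuous_ball_coord k :
  continuous (fun z => (z : 'cV[R[i]]_m) k 0).
Proof.
move=> z; apply: (@continuous_comp _ _ _ (@ball_val R m)
  (fun M : 'cV[R[i]]_m => M k 0)); last exact: coord_continuous.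
exact: initial_continuous.
Qed.

Lemma measurable_borelBall (f : borelBall R m -> R) :
  continuous (f : Ball R m -> R) -> measurable_fun setT f.
Proof.
move=> /continuousP cf; apply: (measurability _ (RGenOpens.measurableE R)).
move=> _ [_ [a [b ->] <-]]; rewrite setTI; apply: sub_sigma_algebra.
exact/cf/interval_open.
Qed.

(** Borel sets are Caratheodory measurable for the outer measure generated by [mu]. *)
Lemma measurable_mu_type (mu : {measure set (borelBall R m) -> \bar R})
    (D : set (mu_type mu)) (f : mu_type mu -> R) :
  continuous (f : Ball R m -> R) -> measurable_fun D f.
Proof.
move=> cf; apply: (@measurable_funS _ _ _ _ setT) => //.
move=> _ Y mY; rewrite setTI; apply: caratheodory_measurable_mu_ext.
by have := measurable_borelBall cf measurableT mY; rewrite setTI.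
Qed.

Lemma measurable_cRe_coord (mu : {measure set (borelBall R m) -> \bar R})
    (D : set (mu_type mu)) k :
  measurable_fun D (fun w => complex.Re (@ball_val R m w k 0)).
Proof.
apply: measurable_mu_type => z.
apply: continuous_comp; [exact: continuous_ball_coord | exact: continuous_cRe].
Qed.

Lemma measurable_cIm_coord (mu : {measure set (borelBall R m) -> \bar R})
    (D : set (mu_type mu)) k :
  measurable_fun D (fun w => complex.Im (@ball_val R m w k 0)).
Proof.
apply: measurable_mu_type => z.
apply: continuous_comp; [exact: continuous_ball_coord | exact: continuous_cIm].
Qed.

End BallMeasurability.

(** * Application to the inclusion of the ball under the completed measure *)

Unset Implicit Arguments.

Theorem theorem5p1 (R : realType) (m : nat) (m_gt0 : (0 < m)%N)
    (mu : {measure set (borelBall R m) -> \bar R}) (mu_lusin : lusinN mu)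
    (K : set (mu_type mu)) (mK : measurable K)
    (K_gt0 : (0 < completion mu K)%E)
    (K_fin : (completion mu K < +oo)%E) :
  exists2 a : Ball R m,
    unique (fun b : Ball R m =>
      vintegral (completion mu) K
        (fun z => p_ b (z : Ball R m)) = 0) a
    & forall z : Ball R m, (L_ K a <= L_ K z)%E.
Proof.
have Xball (z : Ball R m) : nsq (ball_val z) < 1.
  by apply/unit_ballE; have := valP z; rewrite inE.
have mX k : @cmeasurable _ (mu_type mu) R K (fun w => @ball_val R m w k 0).
  by split; [exact: measurable_cRe_coord | exact: measurable_cIm_coord].
have [a a1 amin] := exists_psi_min mK K_gt0 K_fin Xball mX.
have aball : a \in unit_ball R m by rewrite inE; apply/unit_ballE.
have bary := psi_min_barycentric mK K_gt0 K_fin Xball mX a1 amin.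
exists (exist _ a aball : Ball R m).
  split; first exact: bary.
  (* A second barycentric point would have a strictly smaller [psi] than the minimum point [a]. *)
  move=> b bbary; apply: val_inj => /=; apply/eqP; apply: contraT => ab.
  have := barycentric_psi_lt mK K_gt0 K_fin Xball mX (Xball b) a1 bbary ab.
  by rewrite ltNge amin // Xball.
move=> z; apply: (le_integral_logker mK K_fin Xball mX a1 (Xball z)).
exact: amin.
Qed.
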